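(* Let $(X,Q,\pi)$ be a finite Markov chain and $\theta$ an arbitrary mean. Let $\lambda_1(X)$ denote the smallest positive eigenvalue of $-\Delta$. Then $$\lambda_1(X)=K_\infty(\mathbf{1}_X),$$ where $\mathbf{1}_X$ is the equilibrium measure, $\mathbf{1}_X(x)=1$ for all $x\in X$, and consequently $$\lambda_1(X)\ge K_\infty(X).$$
   Context: A finite Markov chain $(X,Q,\pi)$ is always assumed irreducible and reversible: $X$ is a finite set, $Q:X\times X\to[0,1]$ satisfies $\sum_{y}Q(x,y)=1$ for all $x$ and is irreducible, $\pi\in(0,1]^X$ is the unique stationary probability measure, and $Q(x,y)\pi(x)=Q(y,x)\pi(y)$ for all $x,y$. For $f,g\in\mathbb{R}^X$ put $\langle f,g\rangle_\pi=\sum_{x}f(x)g(x)\pi(x)$ and $\Delta f(x)=\sum_{y}(f(y)-f(x))Q(x,y)$. A mean is a function $\theta:[0,\infty)\times[0,\infty)\to[0,\infty)$ which is continuous, smooth on $(0,\infty)\times(0,\infty)$, symmetric, monotone ($\theta(r,s)\ge\theta(t,s)$ for $r\ge t$), homogeneous ($\theta(\lambda r,\lambda s)=\lambda\theta(r,s)$) and normalized ($\theta(1,1)=1$). Set $I_\theta=(0,\infty)$ if $\theta(0,s)=0$ for all $s>0$, and $I_\theta=[0,\infty)$ if $\theta(0,s)>0$ for all $s>0$. Write $\partial_1\theta(r,s)=\frac{\partial}{\partial r}\theta(r,s)$ (at boundary points $r=0$ or $s=0$, relevant only if $I_\theta=[0,\infty)$, this is the one-sided partial derivative, implicitly assumed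 to exist where it is used). For $\rho\in(I_\theta)^X$ define $\Delta_\rho f(x)=\sum_{y}2\,\partial_1\theta(\rho(x),\rho(y))(f(y)-f(x))Q(x,y)$, $2\Gamma_\rho(f,g)=\Delta_\rho(fg)-f\Delta_\rho g-g\Delta_\rho f$, $2\Gamma_{2,\rho}(f,g)=\Delta\Gamma_\rho(f,g)-\Gamma_\rho(f,\Delta g)-\Gamma_\rho(g,\Delta f)$, and $\Gamma_\rho f=\Gamma_\rho(f,f)$, $\Gamma_{2,\rho}f=\Gamma_{2,\rho}(f,f)$. For $\rho\in(I_\theta)^X$, $K_\infty(\rho)$ is the supremum of all $K\in\mathbb{R}$ such that $\langle\rho,\Gamma_{2,\rho}f-K\Gamma_\rho f\rangle_\pi\ge0$ for all $f\in\mathbb{R}^X$. $K_\infty(X)\in[-\infty,\infty]$ is the supremum of all $K\in\mathbb{R}$ for which this inequality holds for all $\rho\in(I_\theta)^X$ and all $f\in\mathbb{R}^X$. *)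

(* Defs.v *)
From HB Require Import structures.
From mathcomp Require Import all_boot all_order all_algebra.
From mathcomp Require Import all_classical all_reals all_analysis.

Set Implicit Arguments.
Unset Strict Implicit.
Unset Printing Implicit Defensive.

Import Order.TTheory GRing.Theory Num.Theory.
Import numFieldNormedType.Exports.

Local Open Scope classical_set_scope.
Local Open Scope ring_scope.

(* Irreducibility makes the stationary probability measure pi unique. *)
Record reversible_markov_chain (R : realType) (X : finType)
    (Q : X -> X -> R) (pi : X -> R) : Prop := ReversibleMarkovChain {
  mc_range : forall x y, 0 <= Q x y <= 1;
  mc_sum1 : forall x, \sum_y Q x y = 1;
  mc_irreducible : forall x y, connect (fun u v => 0 < Q u v) x y;
  mc_pi_range : forall x, 0 < pi x <= 1;
  mc_pi_sum1 : \sum_x pi x = 1;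
  mc_stationary : forall y, \sum_x pi x * Q x y = pi y;
  mc_reversible : forall x y, Q x y * pi x = Q y x * pi y
}.

Section Means.
Variable R : realType.

(* [g] is k times continuously differentiable on the open quadrant.  Only the
   values of [g] there matter: derivatives at interior points are local. *)
Fixpoint Ck_quadrant (k : nat) (g : R -> R -> R) : Prop :=
  (forall r s : R, 0 < r -> 0 < s ->
     {for (r, s), continuous (fun p : R * R => g p.1 p.2)})
  /\ if k is k'.+1 then
       [/\ forall r s : R, 0 < r -> 0 < s ->
             derivable (g ^~ s) r 1 /\ derivable (g r) s 1,
           Ck_quadrant k' (fun r s => derive1 (g ^~ s) r) &
           Ck_quadrant k' (fun r s => derive1 (g r) s)]
     else True.

(* Means are functions on [0, +oo[ ^ 2; they are represented by functions on
   R ^ 2 whose values outside the closed quadrant are irrelevant. *)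
Record is_mean (theta : R -> R -> R) : Prop := IsMean {
  mean_ge0 : forall r s : R, 0 <= r -> 0 <= s -> 0 <= theta r s;
  mean_continuous :
    {within [set p : R * R | 0 <= p.1 /\ 0 <= p.2],
      continuous (fun p : R * R => theta p.1 p.2)};
  mean_smooth : forall k, Ck_quadrant k theta;
  mean_symmetric : forall r s : R, 0 <= r -> 0 <= s -> theta r s = theta s r;
  mean_monotone : forall r t s : R, 0 <= t -> t <= r -> 0 <= s ->
    theta t s <= theta r s;
  mean_homogeneous : forall l r s : R, 0 < l -> 0 <= r -> 0 <= s ->
    theta (l * r) (l * s) = l * theta r s;
  mean_normalized : theta 1 1 = 1
}.

(* By homogeneity, the two cases "theta 0 s > 0 for all s > 0" and
   "theta 0 s = 0 for all s > 0" are exhaustive for a mean. *)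
Definition Itheta (theta : R -> R -> R) : set R :=
  if `[< forall s : R, 0 < s -> 0 < theta 0 s >] then `[0, +oo[%classic
  else `]0, +oo[%classic.

(* The limit of difference quotients inside the domain [0, +oo[: the usual
   partial derivative for r > 0, the right derivative for r = 0.  [lim] has a
   conventional value if the one-sided derivative does not exist. *)
Definition partial1 (theta : R -> R -> R) (r s : R) : R :=
  lim ((fun t => (theta t s - theta r s) / (t - r))
         @ within [set t | 0 <= t] r^').

End Means.

Section Curvature.
Variables (R : realType) (X : finType) (Q : X -> X -> R) (pi : X -> R).
Variable theta : R -> R -> R.
Implicit Types (f g rho : X -> R).

Definition inner_pi f g : R := \sum_x f x * g x * pi x.

Definition Delta f : X -> R := fun x => \sum_y (f y - f x) * Q x y.

Definition Delta_rho rho f : X -> R := fun x =>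
  \sum_y 2 * partial1 theta (rho x) (rho y) * (f y - f x) * Q x y.

Definition Gamma_rho rho f g : X -> R := fun x =>
  (Delta_rho rho (fun z => f z * g z) x
   - f x * Delta_rho rho g x - g x * Delta_rho rho f x) / 2.

Definition Gamma2_rho rho f g : X -> R := fun x =>
  (Delta (Gamma_rho rho f g) x
   - Gamma_rho rho f (Delta g) x - Gamma_rho rho g (Delta f) x) / 2.

Definition curvature_ineq (K : R) rho f : Prop :=
  0 <= inner_pi rho
         (fun x => Gamma2_rho rho f f x - K * Gamma_rho rho f f x).

(* [ereal_sup] is -oo on the empty set of admissible K. *)
Definition Kinfty_at rho : \bar R :=
  ereal_sup [set K%:E | K in [set K : R | forall f, curvature_ineq K rho f]].

Definition Kinfty : \bar R :=
  ereal_sup [set K%:E | K in [set K : R |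
    forall rho, (forall x, Itheta theta (rho x)) ->
    forall f, curvature_ineq K rho f]].

Definition eigenvalue_opp_Delta (l : R) : Prop :=
  exists f, f <> (fun=> 0) /\ forall x, - Delta f x = l * f x.

Definition positive_eigenvalues : set R :=
  [set l : R | 0 < l /\ eigenvalue_opp_Delta l].

(* The infimum is a minimum as soon as there is a positive eigenvalue (lemma
   [lambda1_min] below); on a one-point chain there is none, and the value is
   +oo, as is that of [Kinfty_at]. *)
Definition lambda1 : \bar R := ereal_inf [set l%:E | l in positive_eigenvalues].

Let L : 'M[R]_#|X| := \matrix_(i, j)
  ((i == j)%:R * (\sum_y Q (enum_val j) y) - Q (enum_val j) (enum_val i)).

Let eigenvalue_opp_Delta_root (l : R) :
  eigenvalue_opp_Delta l -> root (char_poly L) l.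
Proof.
move=> [f [f0 fl]]; rewrite -eigenvalue_root_char; apply/eigenvalueP.
exists (\row_i f (enum_val i)).
  apply/rowP => j; rewrite !mxE -fl /Delta.
  under eq_bigr do rewrite !mxE mulrBr.
  rewrite sumrB (bigD1 j)//= eqxx mul1r [X in _ + X - _]big1 ?addr0; last first.
    by move=> i ij; rewrite (negbTE ij) mul0r mulr0.
  under [in RHS]eq_bigr do rewrite mulrBl.
  rewrite sumrB opprB mulr_sumr; congr (_ - _).
  by rewrite [RHS](reindex (@enum_val X X))//=; apply: onW_bij; exact: enum_val_bij.
apply/eqP => /rowP v0; apply: f0; apply/funext => x.
by have := v0 (enum_rank x); rewrite !mxE enum_rankK.
Qed.

Lemma lambda1_min : positive_eigenvalues !=set0 ->
  exists l : R, [/\ lambda1 = l%:E, positive_eigenvalues l &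
    forall l', positive_eigenvalues l' -> l <= l'].
Proof.
move=> [l0 Pl0].
have [l [Pl lmin]] : exists l, positive_eigenvalues l /\
    forall l', positive_eigenvalues l' -> l <= l'.
  apply: contrapT => nomin.
  have chain n : exists l s, [/\ positive_eigenvalues l, size s = n,
      uniq s & forall m, m \in s -> l < m /\ positive_eigenvalues m].
    elim: n => [|n [l [s [Pl sn us ls]]]]; first by exists l0, [::].
    have [l' [Pl' ltl']] : exists l', positive_eigenvalues l' /\ l' < l.
      apply: contrapT => H; apply: nomin; exists l; split=> // l' Pl'.
      by rewrite leNgt; apply/negP => ltl'; apply: H; exists l'.
    exists l', (l :: s); split=> //=; first by rewrite sn.
      by rewrite us andbT; apply/negP => /ls[]; rewrite ltxx.
    move=> m; rewrite inE => /predU1P[-> //|/ls[lm Pm]]; split=> //.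
    exact: lt_trans lm.
  have [l [s [_ sn us ls]]] := chain (size (char_poly L)).
  have p0 : char_poly L != 0 by rewrite monic_neq0// char_poly_monic.
  suff: (size s < size (char_poly L))%N by rewrite sn ltnn.
  apply: max_poly_roots => //; apply/allP => m /ls[_ [_]].
  exact: eigenvalue_opp_Delta_root.
exists l; split=> //; apply/eqP; rewrite eq_le; apply/andP; split.
  by apply: ereal_inf_lbound; exists l.
by apply: le_ereal_inf_tmp => _ [m Pm <-]; rewrite lee_fin; exact: lmin.
Qed.

End Curvature.

(* Main.v *)
Require Import Defs.
From mathcomp Require Import all_boot all_order all_algebra.
From mathcomp Require Import all_classical all_reals all_analysis.
From mathcomp Require Import ring lra.

(** At the constant density 1 the weighted operators are the unweighted ones:
    homogeneity, symmetry and normalization force the partial derivative of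
    every mean at (1, 1) to be 1/2 ([partial1_mean_diag]).  Since Delta is
    selfadjoint and kills constants, integrating Gamma(f, g) against pi gives
    - <f, Delta g>, and the curvature inequality with constant K becomes
    0 <= <(Delta^2 + K Delta) f, f> ([curvature_ineq1E]): the mean has
    disappeared, and what is left is the classical integrated Bochner
    inequality.

    Spectrally, with A = - Delta, the inequality says that a (a - K) >= 0 for
    every eigenvalue a of A.  As A is nonnegative, for K > 0 this holds exactly
    when K is at most every positive eigenvalue.  One direction is a test on an
    eigenvector ([bochner_eigenvalue_ge]).  The other one ([bochner_psd]) needs
    only the existence of a lowest eigenvector, obtained by minimizing a
    quadratic form on the compact unit sphere ([lowest_eigenvector]), instead
    of a full diagonalization: if the form of A^2 - K A takes a negative value,
    then A^2 - K A has an eigenvalue mu < 0, and factoring the polynomial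
    t^2 - K t - mu as (t - a) (t - b) produces an eigenvalue a or b of A.  Both
    roots lie in ]0, K[, because their sum is K and their product is - mu > 0.

    If there is a positive eigenvalue, the smallest one is thus the largest
    admissible K; if there is none, every K > 0 is admissible and both sides
    are +oo.  The inequality for the global curvature follows because 1 is one
    of the densities over which it quantifies. *)

Set Implicit Arguments.
Unset Strict Implicit.
Unset Printing Implicit Defensive.

Import Order.TTheory GRing.Theory Num.Theory.
Import numFieldNormedType.Exports.

Local Open Scope classical_set_scope.
Local Open Scope ring_scope.

(** * The partial derivative of a mean on the diagonal *)

Section MeanOnDiagonal.
Variable R : realType.
Implicit Types (theta : R -> R -> R) (g : R -> R).

(** The values near 1 satisfy theta(r, 1) = r theta(1/r, 1), by homogeneity and
    symmetry.  Differentiating this at r = 1 gives d = theta(1, 1) - d = 1 - d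
    for the derivative d. *)
Lemma is_derive_mean_diag theta : is_mean theta ->
  is_derive (1 : R) (1 : R) (theta ^~ 1) (1 / 2).
Proof.
move=> mtheta.
have [_ [/(_ 1 1 ltr01 ltr01)[dtheta _] _ _]] := mean_smooth mtheta 1.
pose d := 'D_(1 : R) (theta ^~ 1) (1 : R).
have Dtheta : is_derive (1 : R) (1 : R) (theta ^~ 1) d by exact/derivableP.
have Dinv : is_derive (1 : R) (1 : R) (fun r : R => r^-1) (- 1).
  have := @is_deriveV R id 1 1 1 (oner_neq0 _) (is_derive_id _ _).
  by rewrite expr1n invr1 scaleN1r.
have Dcomp : is_derive (1 : R) (1 : R) ((theta ^~ 1) \o (fun r : R => r^-1)) (d * - 1).
  by apply: is_derive1_comp; rewrite invr1.
have Dflip : is_derive (1 : R) (1 : R)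
    (fun r : R => r * theta r^-1 1) (1 - d).
  have := @is_deriveM _ _ id _ (1 : R) (1 : R) _ _ (is_derive_id _ _) Dcomp.
  rewrite [X in is_derive _ _ _ X](_ : _ = 1 - d) //=.
  by rewrite invr1 (mean_normalized mtheta) /GRing.scale /=; ring.
have flip : \forall r \near (1 : R), r * theta r^-1 1 = theta r 1.
  near=> r; have r0 : 0 < r by near: r; exact: lt_nbhsr.
  have rV0 : 0 <= r^-1 by rewrite invr_ge0 ltW.
  rewrite -(mean_homogeneous mtheta)// mulr1 mulfV ?gt_eqF//.
  by rewrite (mean_symmetric mtheta)// ltW.
have := near_eq_is_derive flip Dflip.
move=> /(@derive_val _ _ _ _ _ _ _); rewrite -/d => dd.
by have <- : d = 1 / 2 by lra.
Unshelve. all: by end_near. Qed.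

(** At an interior point of [0, +oo[ the one-sided limit that defines
    [partial1] is the ordinary derivative. *)
Lemma lim_difference_quotient g (a d : R) : 0 < a -> is_derive a 1 g d ->
  lim ((fun t => (g t - g a) / (t - a)) @ within [set t | 0 <= t] a^') = d.
Proof.
move=> a0 [dg dgE].
have -> : within [set t : R | 0 <= t] a^' = a^'.
  rewrite eqEsubset; split => P.
    rewrite /within /= => H.
    have H0 : \forall t \near a^', 0 <= t.
      by apply: nbhs_dnbhs; exact: lt_le_nbhsr.
    by move: H; apply: filterS2 H0 => t t0; apply.
  by move=> H; exact: filterS H.
apply: cvg_lim => //.
have H : (fun h => h^-1 *: ((g \o shift a) (h *: 1) - g a)) @ 0^' --> d.
  by rewrite -dgE; exact: dg.
apply/cvgrPdist_lt => e e0.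
move: H => /cvgrPdist_lt/(_ _ e0)[r /= r0 Hr].
exists r => //= t /= tr ta.
have := Hr (t - a); rewrite /= sub0r normrN -normrN opprB subr_eq0 => /(_ tr ta).
by rewrite scaler1 subrK mulrC.
Unshelve. all: by end_near. Qed.

Lemma partial1_mean_diag theta : is_mean theta -> partial1 theta 1 1 = 1 / 2.
Proof.
by move=> /is_derive_mean_diag; exact: lim_difference_quotient.
Qed.

End MeanOnDiagonal.

(** * Lowest eigenvector of a selfadjoint operator *)

Lemma continuous_sum (R : realType) (S : topologicalType) (X : finType)
    (F : X -> S -> R) :
  (forall x, continuous (F x)) -> continuous (fun f => \sum_x F x f).
Proof.
by move=> cF; apply: continuous_big => //; exact: add_continuous.
Qed.

Section LowestEigenvector.
Variables (R : realType) (X : finType) (pi : X -> R).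
Implicit Types f g h : X -> R.

Lemma inner_piC f g : inner_pi pi f g = inner_pi pi g f.
Proof. by apply: eq_bigr => x _; rewrite [f x * _]mulrC. Qed.

Lemma inner_piDl t f g h :
  inner_pi pi (fun x => f x + t * g x) h =
  inner_pi pi f h + t * inner_pi pi g h.
Proof.
rewrite /inner_pi mulr_sumr -big_split /=; apply: eq_bigr => x _; ring.
Qed.

Lemma inner_piDr t f g h :
  inner_pi pi h (fun x => f x + t * g x) =
  inner_pi pi h f + t * inner_pi pi h g.
Proof. by rewrite inner_piC inner_piDl ![inner_pi pi _ h]inner_piC. Qed.

Lemma inner_piZ c f g :
  inner_pi pi (fun x => c * f x) (fun x => c * g x) = c ^+ 2 * inner_pi pi f g.
Proof. by rewrite /inner_pi mulr_sumr; apply: eq_bigr => x _; ring. Qed.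

Hypothesis pi_gt0 : forall x, 0 < pi x.

Lemma inner_pi_ge0 f : 0 <= inner_pi pi f f.
Proof.
by apply: sumr_ge0 => x _; rewrite mulr_ge0 ?(ltW (pi_gt0 x))// -expr2 sqr_ge0.
Qed.

Lemma inner_pi_eq0 f : inner_pi pi f f = 0 -> f = (fun=> 0).
Proof.
move=> /eqP; rewrite psumr_eq0 => [/allP f0|x _]; last first.
  by rewrite mulr_ge0 ?(ltW (pi_gt0 x))// -expr2 sqr_ge0.
apply/funext => x; apply/eqP.
have := f0 x (mem_index_enum x).
by rewrite /= mulf_eq0 (gt_eqF (pi_gt0 x)) orbF mulf_eq0 orbb.
Qed.

Variable T : (X -> R) -> X -> R.
Hypothesis T_linear : forall t f g,
  T (fun x => f x + t * g x) = (fun x => T f x + t * T g x).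
Hypothesis T_selfadjoint : forall f g,
  inner_pi pi (T f) g = inner_pi pi f (T g).
Hypothesis T_continuous : forall x,
  continuous ((fun f => T f x) : {ptws X -> R} -> R).

Let sphere : set {ptws X -> R} := [set f | inner_pi pi f f = 1].

Let continuous_inner_pi (F G : {ptws X -> R} -> X -> R) :
  (forall x, continuous (fun f : {ptws X -> R} => F f x)) ->
  (forall x, continuous (fun f : {ptws X -> R} => G f x)) ->
  continuous (fun f : {ptws X -> R} => inner_pi pi (F f) (G f)).
Proof.
move=> cF cG.
have := @continuous_sum R {ptws X -> R} X (fun x f => F f x * G f x * pi x).
apply=> x f.
exact: cvgMr_tmp (cvgM (cF x f) (cG x f)).
Qed.

Let continuous_coord (x : X) : continuous ((fun f => f x) : {ptws X -> R} -> R).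
Proof. exact: (@proj_continuous X (fun=> R) x). Qed.

(* A point of the sphere has coordinates f x ^+ 2 <= (pi x)^-1; the box uses the
   larger bound 1 + (pi x)^-1 on `|f x|, which avoids a square root. *)
Let compact_sphere : compact sphere.
Proof.
pose box := [set f : {ptws X -> R} |
  forall x, `[- (1 + (pi x)^-1), 1 + (pi x)^-1]%classic (f x)].
apply: (@subclosed_compact _ _ box).
- have -> : sphere = (fun f : {ptws X -> R} => inner_pi pi f f : R) @^-1` [set 1] by [].
  apply: preimage_closed; last exact: closed_eq.
  by move=> f _; exact: continuous_inner_pi.
- have := @tychonoff X (fun=> R) (fun x => `[- (1 + (pi x)^-1), 1 + (pi x)^-1]%classic).
  by apply=> x; exact: segment_compact.
- move=> f; rewrite /sphere /= => f1 x /=.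
  have fpi : f x ^+ 2 * pi x <= 1.
    rewrite -f1 /inner_pi (bigD1 x) //= expr2 lerDl sumr_ge0 // => y _.
    by rewrite mulr_ge0 ?(ltW (pi_gt0 y))// -expr2 sqr_ge0.
  have fV : f x ^+ 2 <= (pi x)^-1 by rewrite -(ler_pM2r (pi_gt0 x)) mulVf ?gt_eqF.
  have V0 : 0 < (pi x)^-1 by rewrite invr_gt0.
  rewrite /= in_itv /=; apply/andP; split; nra.
Qed.

(** A minimizer g of <T f, f> on the unit sphere, with minimum mu, is an
    eigenvector: the form <T f, f> - mu <f, f> is nonnegative and vanishes at g,
    so its derivative at g in the direction w = T g - mu g, which is
    2 <w, w>, must vanish. *)
Lemma lowest_eigenvector f : inner_pi pi (T f) f < 0 ->
  exists mu g, [/\ mu < 0, g <> (fun=> 0) & T g = (fun x => mu * g x)].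
Proof.
move=> Tf_lt0.
have T0 : T (fun=> 0) = (fun=> 0).
  have := T_linear (-1) (fun=> 0) (fun=> 0).
  under [X in T X]eq_fun do rewrite mulr0 addr0.
  by move=> ->; apply/funext => x; rewrite mulN1r subrr.
have TZ c g : T (fun x => c * g x) = (fun x => c * T g x).
  have := T_linear c (fun=> 0) g; rewrite T0.
  under [X in T X]eq_fun do rewrite add0r.
  by under [X in _ = X]eq_fun do rewrite add0r.
have normalize g : inner_pi pi g g != 0 ->
    exists c, c ^+ 2 * inner_pi pi g g = 1.
  move=> g0; exists (Num.sqrt (inner_pi pi g g))^-1.
  by rewrite exprVn sqr_sqrtr ?inner_pi_ge0// mulVf.
have f_neq0 : inner_pi pi f f != 0.
  apply/eqP => /inner_pi_eq0 f0; move: Tf_lt0; rewrite f0 /inner_pi big1 ?ltxx//.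
  by move=> x _; rewrite mulr0 mul0r.
have sphere0 : sphere !=set0.
  have [c c1] := normalize _ f_neq0.
  by exists (fun x => c * f x); rewrite /sphere /= inner_piZ.
have [] := @compact_EVT_min {ptws X -> R} R
    (fun g : {ptws X -> R} => inner_pi pi (T g) g) _ sphere0 compact_sphere.
  by apply: continuous_subspaceT; exact: continuous_inner_pi.
move=> g; rewrite inE => g1 gmin.
set mu := inner_pi pi (T g) g in gmin.
have mu_le h : mu * inner_pi pi h h <= inner_pi pi (T h) h.
  have [h0|h0] := eqVneq (inner_pi pi h h) 0.
    rewrite h0 mulr0 (inner_pi_eq0 h0) /inner_pi big1// => x _.
    by rewrite mulr0 mul0r.
  have [c c1] := normalize _ h0.
  have := gmin (fun x => c * h x).
  rewrite inE /sphere /= inner_piZ => /(_ c1); rewrite TZ inner_piZ => le.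
  have hh : 0 < inner_pi pi h h by rewrite lt_def h0 inner_pi_ge0.
  have : inner_pi pi h h * mu <= inner_pi pi h h * (c ^+ 2 * inner_pi pi (T h) h).
    by rewrite ler_pM2l.
  by rewrite mulrA [_ * c ^+ 2]mulrC c1 mul1r mulrC.
exists mu, g; split.
- have ff : 0 < inner_pi pi f f by rewrite lt_def f_neq0 inner_pi_ge0.
  by have := mu_le f; nra.
- move=> g0; have := g1; rewrite /sphere /= g0 /inner_pi big1 => [/esym/eqP|x _].
    by rewrite oner_eq0.
  by rewrite mulr0 mul0r.
(* w is kept abstract, or rewriting with [inner_piDr] would unfold it. *)
have [w wE] : exists w, w = (fun x => T g x + - mu * g x) by eexists.
suff /inner_pi_eq0 w0 : inner_pi pi w w = 0.
  by apply/funext => x; have /(congr1 (@^~ x)) := w0; rewrite wE /=; lra.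
have ww : inner_pi pi w w = inner_pi pi (T g) w - mu * inner_pi pi g w.
  by rewrite {1}wE inner_piDl mulNr.
have Tw : inner_pi pi (T w) g = inner_pi pi (T g) w.
  by rewrite T_selfadjoint inner_piC.
(* The nonnegative form at g + t w; its constant term vanishes, so its linear
   coefficient 2 <w, w> has to vanish as well. *)
have quad t : 0 <= 2 * t * inner_pi pi w w
    + t ^+ 2 * (inner_pi pi (T w) w - mu * inner_pi pi w w).
  have := mu_le (fun x => g x + t * w x).
  rewrite T_linear !inner_piDl !inner_piDr Tw -/mu [inner_pi pi w g]inner_piC.
  have g1' : inner_pi pi g g = 1 := g1.
  rewrite g1'; move: ww; set N := inner_pi pi w w => ->; lra.
move: quad; set N := inner_pi pi w w; set c := _ - _ => quad.
apply/eqP; rewrite eq_le inner_pi_ge0 andbT leNgt; apply/negP => N0.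
have [c0|c0] := leP c 0; first by have := quad (-1); rewrite -/N in N0 *; nra.
(* The vertex of the parabola, where its value is - N^2 / c. *)
have := quad (- (N / c)).
have -> : 2 * - (N / c) * N + (- (N / c)) ^+ 2 * c = - (N ^+ 2 / c).
  by field; rewrite gt_eqF.
by rewrite oppr_ge0 leNgt divr_gt0 ?exprn_gt0.
Qed.

End LowestEigenvector.

(** * The integrated Bochner inequality and the spectral gap *)

Section SpectralGap.
Variables (R : realType) (X : finType) (Q : X -> X -> R) (pi : X -> R).
Hypothesis hchain : reversible_markov_chain Q pi.
Implicit Types f g : X -> R.

Let pi_gt0 x : 0 < pi x.
Proof. by have /andP[] := mc_pi_range hchain x. Qed.

Lemma Delta_linear t f g :
  Delta Q (fun x => f x + t * g x) = (fun x => Delta Q f x + t * Delta Q g x).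
Proof.
apply/funext => x; rewrite /Delta mulr_sumr -big_split /=.
by apply: eq_bigr => y _; ring.
Qed.

Lemma Delta_selfadjoint f g :
  inner_pi pi (Delta Q f) g = inner_pi pi f (Delta Q g).
Proof.
have DeltaE h x : Delta Q h x = \sum_y h y * Q x y - h x.
  rewrite /Delta; under eq_bigr do rewrite mulrBl.
  by rewrite sumrB -mulr_sumr (mc_sum1 hchain) mulr1.
rewrite /inner_pi.
under eq_bigr do rewrite DeltaE mulrBl mulrBl !mulr_suml.
under [RHS]eq_bigr do rewrite DeltaE mulrBr mulrBl mulr_sumr mulr_suml.
rewrite !sumrB; congr (_ - _); rewrite exchange_big /=.
apply: eq_bigr => x _; apply: eq_bigr => y _.
transitivity (f x * g y * (Q y x * pi y)); first by ring.
by rewrite -(mc_reversible hchain x y); ring.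
Qed.

Lemma inner_pi_Delta1 f : inner_pi pi (fun=> 1) (Delta Q f) = 0.
Proof.
rewrite -Delta_selfadjoint /inner_pi big1// => x _.
by rewrite /Delta big1 ?mul0r// => y _; rewrite subrr mul0r.
Qed.

(** The operator of the quadratic form to which the curvature inequality reduces
    at the constant density 1; in terms of A = - Delta it is A^2 - K A. *)
Definition bochner (K : R) f x := Delta Q (Delta Q f) x + K * Delta Q f x.

Lemma bochner_linear K t f g :
  bochner K (fun x => f x + t * g x) =
  (fun x => bochner K f x + t * bochner K g x).
Proof. by rewrite /bochner !Delta_linear; apply/funext => x; ring. Qed.

Lemma bochner_selfadjoint K f g :
  inner_pi pi (bochner K f) g = inner_pi pi f (bochner K g).
Proof.
by rewrite /bochner inner_piDl inner_piDr !Delta_selfadjoint.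
Qed.

Lemma continuous_Delta (F : {ptws X -> R} -> X -> R) x :
  (forall y, continuous (fun f : {ptws X -> R} => F f y)) ->
  continuous (fun f : {ptws X -> R} => Delta Q (F f) x).
Proof.
move=> cF.
have := @continuous_sum R {ptws X -> R} X (fun y f => (F f y - F f x) * Q x y).
apply=> y f.
exact: cvgMr_tmp (cvgB (cF y f) (cF x f)).
Qed.

Lemma continuous_bochner K x :
  continuous ((fun f => bochner K f x) : {ptws X -> R} -> R).
Proof.
have cD y : continuous ((fun f => Delta Q f y) : {ptws X -> R} -> R).
  apply: (@continuous_Delta id) => z; exact: (@proj_continuous X (fun=> R) z).
have cDD := @continuous_Delta (Delta Q) x cD.
by move=> f; exact: cvgD (cDD f) (cvgM (cvg_cst K) (cD x f)).
Qed.

(** With t^2 - K t - mu = (t - a) (t - b), the hypothesis reads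
    (A - a) (A - b) g = 0 for A = - Delta, so either g is an eigenvector of A
    for b, or (A - b) g is one for a.  The roots are real because
    ||(A - K/2) g||^2 = (mu + K^2/4) ||g||^2, and 0 < b <= a < K because
    a + b = K and a b = - mu > 0. *)
Lemma bochner_eigenvector_gap K mu g : 0 < K -> mu < 0 ->
  g <> (fun=> 0) -> bochner K g = (fun x => mu * g x) ->
  exists2 l, positive_eigenvalues Q l & l < K.
Proof.
move=> K0 mu0 g0 Bg.
have gg : 0 < inner_pi pi g g.
  rewrite lt_def inner_pi_ge0// andbT; apply/eqP => /(inner_pi_eq0 pi_gt0).
  exact: g0.
(* h a = - (A - a) g, and Dh computes - (A - b) (h a). *)
pose h a x := Delta Q g x + a * g x.
have Dh a b x : Delta Q (h a) x + b * h a x =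
    mu * g x + (a + b - K) * Delta Q g x + a * b * g x.
  by rewrite /h Delta_linear; have /(congr1 (@^~ x)) := Bg; rewrite /bochner => <-; ring.
have disc : 0 <= K ^+ 2 + 4 * mu.
  have : inner_pi pi (h (K / 2)) (h (K / 2)) = (mu + K ^+ 2 / 4) * inner_pi pi g g.
    rewrite {1}/h inner_piDl Delta_selfadjoint -inner_piDr.
    have -> : (fun x => Delta Q (h (K / 2)) x + K / 2 * h (K / 2) x) =
              (fun x => 0 + (mu + K ^+ 2 / 4) * g x).
      by apply/funext => x; rewrite Dh; field.
    rewrite inner_piDr [X in X + _](_ : _ = 0) ?add0r//.
    by rewrite /inner_pi big1// => x _; rewrite mulr0 mul0r.
  have := inner_pi_ge0 pi_gt0 (h (K / 2)); nra.
(* From here on the roots are b = (K - s) / 2 and a = (K + s) / 2. *)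
pose s := Num.sqrt (K ^+ 2 + 4 * mu).
have s0 : 0 <= s by exact: sqrtr_ge0.
have s2 : s ^+ 2 = K ^+ 2 + 4 * mu by rewrite sqr_sqrtr.
have sK : s < K by nra.
have [hb|hb] := pselect (h ((K - s) / 2) = (fun=> 0)).
  exists ((K - s) / 2); last by lra.
  split; first by lra.
  exists g; split=> // x; have /(congr1 (@^~ x)) := hb; rewrite /h /=; lra.
exists ((K + s) / 2); last by lra.
split; first by lra.
exists (h ((K - s) / 2)); split=> // x.
have := Dh ((K - s) / 2) ((K + s) / 2) x.
have -> : (K - s) / 2 + (K + s) / 2 - K = 0 by field.
have -> : (K - s) / 2 * ((K + s) / 2) = - mu.
  transitivity ((K ^+ 2 - s ^+ 2) / 4); first by field.
  by rewrite s2; field.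
by lra.
Qed.

(** A negative value of the form would produce an eigenvalue of - Delta in
    ]0, K[. *)
Lemma bochner_psd K : 0 < K ->
  (forall l, positive_eigenvalues Q l -> K <= l) ->
  forall f, 0 <= inner_pi pi (bochner K f) f.
Proof.
move=> K0 Kle f; rewrite leNgt; apply/negP => neg.
have [mu [g [mu0 g0 Bg]]] := lowest_eigenvector pi_gt0 (bochner_linear K)
  (bochner_selfadjoint K) (@continuous_bochner K) neg.
have [l /Kle Kl] := bochner_eigenvector_gap K0 mu0 g0 Bg.
by rewrite ltNge Kl.
Qed.

(** On an eigenvector f of - Delta for l the form is l (l - K) <f, f>. *)
Lemma bochner_eigenvalue_ge K l : positive_eigenvalues Q l ->
  (forall f, 0 <= inner_pi pi (bochner K f) f) -> K <= l.
Proof.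
move=> [l0 [f [f0 Df]]] /(_ f).
have ff : 0 < inner_pi pi f f.
  rewrite lt_def inner_pi_ge0// andbT; apply/eqP => /(inner_pi_eq0 pi_gt0).
  exact: f0.
have DE : Delta Q f = (fun x => - l * f x).
  by apply/funext => x; rewrite mulNr -Df opprK.
rewrite /bochner inner_piDl Delta_selfadjoint DE.
rewrite inner_piZ sqrrN.
have -> : inner_pi pi (fun x => - l * f x) f = - l * inner_pi pi f f.
  by rewrite /inner_pi mulr_sumr; apply: eq_bigr => x _; ring.
move=> H; rewrite leNgt; apply/negP => lK.
have : l * inner_pi pi f f * (l - K) < 0 by rewrite pmulr_rlt0 ?mulr_gt0 ?subr_lt0.
by lra.
Qed.

Variable theta : R -> R -> R.
Hypothesis htheta : is_mean theta.

Lemma Gamma_rho1E f g x : Gamma_rho Q theta (fun=> 1) f g x =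
  (Delta Q (fun z => f z * g z) x - f x * Delta Q g x - g x * Delta Q f x) / 2.
Proof.
have DE h : Delta_rho Q theta (fun=> 1) h = Delta Q h.
  apply/funext => y; apply: eq_bigr => z _.
  by rewrite (partial1_mean_diag htheta); field.
by rewrite /Gamma_rho !DE.
Qed.

(** Integration by parts: the term Delta (f g) of the carre du champ integrates
    to 0, and the two others are equal by selfadjointness. *)
Lemma inner_pi_Gamma_rho1 f g :
  inner_pi pi (fun=> 1) (Gamma_rho Q theta (fun=> 1) f g) =
  - inner_pi pi f (Delta Q g).
Proof.
have := inner_pi_Delta1 (fun z => f z * g z).
have := Delta_selfadjoint f g.
rewrite inner_piC => selfadj int0.
suff -> : inner_pi pi (fun=> 1) (Gamma_rho Q theta (fun=> 1) f g) =
    (inner_pi pi (fun=> 1) (Delta Q (fun z => f z * g z))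
     - inner_pi pi f (Delta Q g) - inner_pi pi g (Delta Q f)) / 2.
  by rewrite int0 selfadj; field.
rewrite /inner_pi -!sumrB mulr_suml; apply: eq_bigr => x _.
by rewrite Gamma_rho1E; field.
Qed.

(** The term Delta Gamma(f, f) of Gamma2 integrates to 0, and integration by
    parts turns - Gamma(f, Delta f) - K Gamma(f, f) into
    <f, Delta (Delta f)> + K <f, Delta f>. *)
Lemma curvature_ineq1E K f :
  curvature_ineq Q pi theta K (fun=> 1) f <-> 0 <= inner_pi pi (bochner K f) f.
Proof.
suff -> : inner_pi pi (bochner K f) f = inner_pi pi (fun=> 1)
    (fun x => Gamma2_rho Q theta (fun=> 1) f f x
              - K * Gamma_rho Q theta (fun=> 1) f f x) by [].
transitivity ((inner_pi pi (fun=> 1) (Delta Q (Gamma_rho Q theta (fun=> 1) f f))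
    - 2 * inner_pi pi (fun=> 1) (Gamma_rho Q theta (fun=> 1) f (Delta Q f))) / 2
    - K * inner_pi pi (fun=> 1) (Gamma_rho Q theta (fun=> 1) f f)).
  rewrite inner_pi_Delta1 !inner_pi_Gamma_rho1 /bochner inner_piDl.
  by rewrite ![inner_pi pi f _]inner_piC; field.
rewrite /inner_pi !mulr_sumr -sumrB mulr_suml -sumrB; apply: eq_bigr => x _.
by rewrite /Gamma2_rho; field.
Qed.

End SpectralGap.

Theorem proposition3p9 (R : realType) (X : finType) (Q : X -> X -> R)
    (pi : X -> R) (theta : R -> R -> R)
    (hchain : reversible_markov_chain Q pi) (htheta : is_mean theta) :
  lambda1 Q = Kinfty_at Q pi theta (fun _ : X => 1)
  /\ (lambda1 Q >= Kinfty Q pi theta)%E.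
Proof.
have lambda1E : lambda1 Q = Kinfty_at Q pi theta (fun _ : X => 1).
  apply/eqP; rewrite eq_le; apply/andP; split.
    have [/lambda1_min[l [-> [l0 _] lmin]]|none] :=
        pselect (positive_eigenvalues Q !=set0).
      apply: ereal_sup_ubound; exists l => //= f.
      by apply/(curvature_ineq1E hchain htheta); exact: bochner_psd.
    suff -> : Kinfty_at Q pi theta (fun _ : X => 1) = +oo%E by rewrite leey.
    apply/eqyP => K K0; apply: ereal_sup_ubound; exists K => //= f.
    apply/(curvature_ineq1E hchain htheta); apply: bochner_psd => // l Pl.
    by exfalso; apply: none; exists l.
  apply: ge_ereal_sup => _ [K /= HK <-].
  apply: le_ereal_inf_tmp => _ [l Pl <-]; rewrite lee_fin.
  apply: (bochner_eigenvalue_ge hchain Pl) => f.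
  by apply/(curvature_ineq1E hchain htheta); exact: HK.
split=> //; rewrite lambda1E; apply: ereal_sup_le => _ [K /= HK <-].
exists K => //= f; apply: HK => x; rewrite /Itheta.
by case: ifP => _; rewrite /= in_itv /= ?ler01 ?ltr01.
Qed.
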